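(* Let $\mathcal{G}=(V,E)$ be a finite, simple, connected, undirected graph with privacy function $\varepsilon:E\to[0,\infty)$, let $u\in V$ and $\alpha\in[0,1]$. Run the following procedure: set $S_1=\{u\}$, $A_{u,\alpha}(u)=\alpha$, $i=1$; while $|S_i|<|V|$: for each $v\in N(S_i)$ set $\alpha^*(v)=\min_{v'\in N(v)\cap S_i} f_{\varepsilon(v',v)}(A_{u,\alpha}(v'))$; choose $v_i\in\arg\min_{v\in N(S_i)}\alpha^*(v)$ (ties broken arbitrarily), set $A_{u,\alpha}(v_i)=\alpha^*(v_i)$, $S_{i+1}=S_i\cup\{v_i\}$, and $i\leftarrow i+1$. Then the resulting function $A_{u,\alpha}:V\to[0,1]$ satisfies, for every $v\in V$, $$A_{u,\alpha}(v)=\min_{\rho\in\mathcal{P}(u,v)}U_{\rho,\alpha}(v).$$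
   Context: For $A\subseteq V$, $N(A)$ is the set of vertices of $V\setminus A$ adjacent to some vertex of $A$, and $N(v)=N(\{v\})$. A $(u,v)$-path is a sequence of vertices $u=w_0,w_1,\dots,w_m=v$ with $(w_k,w_{k+1})\in E$ for all $k$; $\mathcal{P}(u,v)$ is the set of all $(u,v)$-paths. For $\varepsilon\ge0$ and $y\in[0,1]$ let $f_\varepsilon(y)=\min\{e^{\varepsilon}y,\ (y-1+e^{\varepsilon})/e^{\varepsilon}\}$. For a path $\rho=(w_0,\dots,w_m)$ and $x\in[0,1]$, the path upper bound function is $U_{\rho,x}(w_0)=x$ and $U_{\rho,x}(w_{k+1})=f_{\varepsilon(w_k,w_{k+1})}(U_{\rho,x}(w_k))$; it is the upper bound on $p(w_m)$ that $p(w_0)=x$ imposes through $\rho$ on any function $p:V\to[0,1]$ satisfying, for every edge $(a,b)$ in both orders, $p(a)\le e^{\varepsilon(a,b)}p(b)$ and $1-p(a)\le e^{\varepsilon(a,b)}(1-p(b))$. *)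

(* Defs.v *)
From HB Require Import structures.
From mathcomp Require Import all_boot all_order all_algebra.
From mathcomp Require Import boolp classical_sets reals sequences exp.

Set Implicit Arguments.
Unset Strict Implicit.
Unset Printing Implicit Defensive.

Import Order.TTheory GRing.Theory Num.Theory.
Local Open Scope ring_scope.

Definition simple_graph (V : finType) (e : rel V) : Prop :=
  symmetric e /\ irreflexive e.

Definition connected_graph (V : finType) (e : rel V) : Prop :=
  forall a b : V, connect e a b.

(* A function on undirected edges: only the values on pairs (a, b) with
   e a b are constrained, and only those are used below. *)
Definition privacy_function (R : realType) (V : finType) (e : rel V)
    (eps : V -> V -> R) : Prop :=
  forall a b : V, e a b -> 0 <= eps a b /\ eps a b = eps b a.

Definition nbhd (V : finType) (e : rel V) (A : {set V}) : {set V} :=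
  [set v | (v \notin A) && [exists a in A, e a v]]%SET.

Definition is_min (R : realType) (X : set R) (m : R) : Prop :=
  X m /\ lbound X m.

Definition fbound (R : realType) (eps y : R) : R :=
  Num.min (expR eps * y) ((y - 1 + expR eps) / expR eps).

(* The path (w_0, ..., w_m) from w_0 = u is represented by its tail
   p = [:: w_1; ...; w_m], so m = size p and w_k = nth u (u :: p) k.
   Vertices may repeat. *)
Definition paths (V : finType) (e : rel V) (u v : V) : set (seq V) :=
  [set p | path e u p /\ last u p = v]%classic.

(* Indexed by the position k, since a vertex may occur several times:
   path_upper eps x u p k is U_{rho,x}(w_k). *)
Fixpoint path_upper (R : realType) (V : finType) (eps : V -> V -> R)
    (x : R) (u : V) (p : seq V) (k : nat) : R :=
  if k is k'.+1 then
    fbound (eps (nth u (u :: p) k') (nth u (u :: p) k'.+1))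
           (path_upper eps x u p k')
  else x.

Definition path_upper_end (R : realType) (V : finType) (eps : V -> V -> R)
    (x : R) (u : V) (p : seq V) : R :=
  path_upper eps x u p (size p).

Definition is_alpha_star (R : realType) (V : finType) (e : rel V)
    (eps : V -> V -> R) (S : {set V}) (A astar : V -> R) : Prop :=
  forall v, v \in nbhd e S ->
    is_min [set fbound (eps v' v) (A v') | v' in
              [set v' | v' \in nbhd e [set v]%SET :&: S]]%classic
           (astar v).

(* One iteration of the loop body, from state (S, A) to state (S', A'). *)
Definition proc_step (R : realType) (V : finType) (e : rel V)
    (eps : V -> V -> R) (S : {set V}) (A : V -> R)
    (S' : {set V}) (A' : V -> R) : Prop :=
  (#|S| < #|V|)%N /\
  exists (astar : V -> R) (vi : V),
    [/\ is_alpha_star e eps S A astar,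
        vi \in nbhd e S,
        (forall v, v \in nbhd e S -> astar vi <= astar v),
        S' = vi |: S &
        A' = [eta A with vi |-> astar vi]].

(* States (S_i, A) reachable at the loop test, for every way of breaking
   ties. The values of A outside S are uninitialised (arbitrary) and are
   never read. *)
Inductive proc_state (R : realType) (V : finType) (e : rel V)
    (eps : V -> V -> R) (u : V) (alpha : R) : {set V} -> (V -> R) -> Prop :=
| ProcInit (A : V -> R) :
    A u = alpha -> proc_state e eps u alpha [set u]%SET A
| ProcStep (S : {set V}) (A : V -> R) (S' : {set V}) (A' : V -> R) :
    proc_state e eps u alpha S A -> proc_step e eps S A S' A' ->
    proc_state e eps u alpha S' A'.

Definition proc_result (R : realType) (V : finType) (e : rel V)
    (eps : V -> V -> R) (u : V) (alpha : R) (A : V -> R) : Prop :=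
  exists S : {set V}, proc_state e eps u alpha S A /\ ~~ (#|S| < #|V|)%N.

(* Main.v *)
(* As in Dijkstra's algorithm, f_eps(y) >= y on [0, 1] makes vertices enter S
   in order of non-decreasing value A, so a vertex added later never improves
   the value of an earlier one: A b <= f_{eps(a,b)}(A a) for every edge (a, b)
   inside S. Monotonicity of f_eps then bounds A by the upper bound of every
   path, and following the minimizers back to u gives a path attaining it. *)
Require Import Defs.
From mathcomp Require Import all_boot all_order all_algebra.
From mathcomp Require Import boolp classical_sets reals sequences exp.
From mathcomp Require Import lra.

Set Implicit Arguments.
Unset Strict Implicit.
Unset Printing Implicit Defensive.

Import Order.TTheory GRing.Theory Num.Theory.
Local Open Scope ring_scope.

(** * The one-edge bound [fbound] *)

(** With E = exp(eps) >= 1, the first branch needs only y >= 0, and the second amounts to (E - 1)(1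
    - y) >= 0. *)
Lemma fbound_ge (R : realType) (eps y : R) :
  0 <= eps -> 0 <= y <= 1 -> y <= fbound eps y.
Proof.
move=> eps0 /andP[y0 y1]; rewrite /fbound le_min.
have E1 : 1 <= expR eps by rewrite -expR0 ler_expR.
by rewrite ler_pdivlMr ?expR_gt0 //; apply/andP; split; nra.
Qed.

Lemma fbound_le1 (R : realType) (eps y : R) : y <= 1 -> fbound eps y <= 1.
Proof.
move=> y1; rewrite /fbound ge_min ler_pdivrMr ?expR_gt0 //.
by apply/orP; right; lra.
Qed.

Lemma fbound_homo (R : realType) (eps : R) :
  {homo fbound eps : x y / x <= y}.
Proof.
move=> x y xy; have E0 := expR_gt0 eps.
rewrite /fbound le_min !ge_min ler_pM2l // xy /= ler_pM2r ?invr_gt0 //.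
by apply/orP; right; lra.
Qed.

Lemma fbound01 (R : realType) (eps y : R) :
  0 <= eps -> 0 <= y <= 1 -> 0 <= fbound eps y <= 1.
Proof.
move=> eps0 y01; have /andP[y0 y1] := y01.
by rewrite fbound_le1 // (le_trans y0) // fbound_ge.
Qed.

(** * Path bounds under extension at the end *)

Lemma path_upper_rcons (R : realType) (V : finType) (eps : V -> V -> R)
    (x : R) (u : V) (p : seq V) (w : V) (k : nat) :
  (k <= size p)%N -> path_upper eps x u (rcons p w) k = path_upper eps x u p k.
Proof.
elim: k => [//|k IHk] k_lt /=.
by rewrite IHk 1?ltnW // -rcons_cons !nth_rcons /= k_lt ltnS ltnW.
Qed.

Lemma path_upper_end_rcons (R : realType) (V : finType) (eps : V -> V -> R)
    (x : R) (u : V) (p : seq V) (w : V) :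
  path_upper_end eps x u (rcons p w) =
  fbound (eps (last u p) w) (path_upper_end eps x u p).
Proof.
rewrite /path_upper_end size_rcons /= path_upper_rcons //.
rewrite -rcons_cons !nth_rcons /= ltnS leqnn ltnn eqxx.
(* [size p] is the last index of [u :: p], so this entry is the endpoint of the path. *)
by rewrite -[nth u (u :: p) _]/(nth u (u :: p) (size (u :: p)).-1) nth_last.
Qed.

(** * Finite minima and neighbourhoods *)

(** Serves twice: for the best predecessor of a frontier vertex, and for the next vertex to
    settle. *)
Lemma finset_is_min (R : realType) (V : finType) (X : {set V}) (f : V -> R) :
  X != finset.set0 ->
  exists2 x, x \in X & is_min [set f y | y in [set y | y \in X]]%classic (f x).
Proof.
move=> /set0Pn[x0 x0X].
have [x xX x_min] := arg_minP f x0X.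
by exists x => //; split; [exists x | move=> _ [y yX <-]; exact: x_min].
Qed.

Lemma in_nbhd1 (V : finType) (e : rel V) (v w : V) :
  (w \in nbhd e [set v]%SET) = (w != v) && e v w.
Proof.
rewrite !inE; congr (_ && _); apply/existsP/idP => [[a]|evw].
  by rewrite inE => /andP[/eqP->].
by exists v; rewrite inE eqxx.
Qed.

Lemma nbhdP (V : finType) (e : rel V) (S : {set V}) (v : V) :
  reflect (v \notin S /\ exists2 a, a \in S & e a v) (v \in nbhd e S).
Proof.
rewrite inE; apply: (iffP andP) => -[vS].
  by move=> /exists_inP; split.
by move=> /exists_inP; split.
Qed.

(** If no edge left [S], then [S] would be closed under adjacency, and connectivity from [u] would
    make it all of [V]. *)
Lemma nbhd_neq0 (V : finType) (e : rel V) (S : {set V}) (u : V) :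
  symmetric e -> connected_graph e -> u \in S -> (#|S| < #|V|)%N ->
  nbhd e S != finset.set0.
Proof.
move=> e_sym e_conn uS; apply: contraTneq => N0.
have S_closed : fingraph.closed e S.
  apply: (intro_closed (sym_connect_sym e_sym)) => a b eab aS.
  apply: contraT => bS.
  have : b \in nbhd e S by apply/nbhdP; split=> //; exists a.
  by rewrite N0 inE.
rewrite -leqNgt -cardsT subset_leq_card //.
apply/fintype.subsetP => v _.
by rewrite -(closed_connect S_closed (e_conn u v)).
Qed.

(** * Candidate values of frontier vertices *)

Section AlphaStar.
Variables (R : realType) (V : finType) (e : rel V) (eps : V -> V -> R).
Variables (S : {set V}) (A : V -> R).
Hypothesis e_sym : symmetric e.

Lemma in_nbhd1_setI v a :
  v \notin S -> (a \in nbhd e [set v]%SET :&: S) = (a \in S) && e a v.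
Proof.
move=> vS; rewrite inE in_nbhd1 e_sym andbC; case: (boolP (a \in S)) => //= aS.
by rewrite (contraNneq _ vS) // => <-.
Qed.

Lemma alpha_star_le astar v a : is_alpha_star e eps S A astar ->
  v \notin S -> a \in S -> e a v -> astar v <= fbound (eps a v) (A a).
Proof.
move=> astarP vS aS eav.
have vN : v \in nbhd e S by apply/nbhdP; split=> //; exists a.
have [_ le_astar] := astarP v vN; apply: le_astar; exists a => //=.
by rewrite in_nbhd1_setI // aS.
Qed.

Lemma alpha_star_attained astar v : is_alpha_star e eps S A astar ->
  v \in nbhd e S ->
  exists a, [/\ a \in S, e a v & astar v = fbound (eps a v) (A a)].
Proof.
move=> astarP vN; have [vS _] := elimT (nbhdP _ _ _) vN.
have [[a /= aN <-] _] := astarP v vN; exists a.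
by move: aN; rewrite in_nbhd1_setI // => /andP[].
Qed.

Lemma alpha_star_exists : exists astar, is_alpha_star e eps S A astar.
Proof.
suff /choice[astar astarP] : forall v, exists m, v \in nbhd e S ->
    is_min [set fbound (eps v' v) (A v') | v' in
              [set v' | v' \in nbhd e [set v]%SET :&: S]]%classic m.
  by exists astar.
(* Off the frontier nothing is required, so [0] is an arbitrary default. *)
move=> v; case: (boolP (v \in nbhd e S)) => [vN|]; last by exists 0.
have [vS [a aS eav]] := elimT (nbhdP _ _ _) vN.
have N0 : nbhd e [set v]%SET :&: S != finset.set0.
  by apply/set0Pn; exists a; rewrite in_nbhd1_setI // aS.
have [x _ x_min] := @finset_is_min _ _ _ (fun w => fbound (eps w v) (A w)) N0.
by exists (fbound (eps x v) (A x)).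
Qed.

End AlphaStar.

(** * The loop invariant and its consequences *)

Section Procedure.
Variables (R : realType) (V : finType) (e : rel V) (eps : V -> V -> R).
Variables (u : V) (alpha : R).
Hypotheses (e_sym : symmetric e) (eps_privacy : privacy_function e eps).
Hypothesis alpha01 : 0 <= alpha <= 1.

(* The last field bounds every settled value by every candidate value for the
   next vertex: this is what keeps the settled values non-decreasing. *)
Record proc_invariant (S : {set V}) (A : V -> R) : Prop := ProcInvariant {
  inv_source : u \in S;
  inv_01 : forall v, v \in S -> 0 <= A v <= 1;
  inv_attained : forall v, v \in S ->
    exists2 p, paths e u v p & path_upper_end eps alpha u p = A v;
  inv_edge : forall a b, a \in S -> b \in S -> e a b ->
    A b <= fbound (eps a b) (A a);
  inv_frontier : forall w a v, w \in S -> a \in S -> v \notin S -> e a v ->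
    A w <= fbound (eps a v) (A a) }.

(** With [u] alone settled, the edge and frontier fields both reduce to [fbound_ge] at [alpha]. *)
Lemma proc_invariant_init A : A u = alpha -> proc_invariant [set u]%SET A.
Proof.
move=> Au; split.
- by rewrite inE.
- by move=> v /set1P->; rewrite Au.
- by move=> v /set1P->; exists [::].
- move=> a b /set1P-> /set1P-> euu.
  by rewrite fbound_ge ?Au //; case: (eps_privacy euu).
- move=> w a v /set1P-> /set1P-> _ euv.
  by rewrite fbound_ge ?Au //; case: (eps_privacy euv).
Qed.

Lemma proc_invariant_step S A S' A' :
  proc_invariant S A -> proc_step e eps S A S' A' -> proc_invariant S' A'.
Proof.
move=> [uS A01 A_att A_edge A_front].
move=> [_ [astar [x [astarP xN x_min -> ->]]]].
have [xS _] := elimT (nbhdP _ _ _) xN.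
have [a0 [a0S ea0x x_att]] := alpha_star_attained e_sym astarP xN.
have eps_ge0 a b (eab : e a b) : 0 <= eps a b by case: (eps_privacy eab).
have neq_x w : w \in S -> (w == x) = false.
  by move=> wS; apply: contraNF xS => /eqP <-.
have x01 : 0 <= astar x <= 1 by rewrite x_att fbound01 ?eps_ge0 ?A01.
(* The edge from [a0] to [x] leaves [S], so the old frontier field applies to it. *)
have le_x w : w \in S -> A w <= astar x.
  by move=> wS; rewrite x_att A_front.
split=> /=.
- by rewrite !inE uS orbT.
- by move=> v /setU1P[->|vS]; rewrite ?eqxx ?(neq_x v) ?A01.
- move=> v /setU1P[->|vS]; rewrite ?eqxx ?(neq_x v) //; last exact: A_att.
  have [p [p_path p_last] p_end] := A_att _ a0S; exists (rcons p x).
    by split; rewrite ?rcons_path ?p_path ?p_last ?last_rcons.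
  by rewrite path_upper_end_rcons p_last p_end x_att.
- move=> a b /setU1P[->|aS] /setU1P[->|bS] eab;
    rewrite ?eqxx ?(neq_x a) ?(neq_x b) //.
  + by rewrite fbound_ge ?eps_ge0.
  (* An edge from the new vertex back to an old one: [A b <= astar x], and [fbound] only increases
     [astar x]. *)
  + by rewrite (le_trans (le_x _ bS)) ?fbound_ge ?eps_ge0.
  + exact: alpha_star_le astarP xS aS eab.
  + exact: A_edge.
(* Every settled value is now at most [astar x]. If [a] is [x], apply [fbound_ge]; otherwise [v] was
   already on the frontier and competed with [x], so [astar x <= astar v]. *)
- move=> w a v wS' aS'; rewrite !inE negb_or => /andP[_ vS] eav.
  have {}wS' : (if w == x then astar x else A w) <= astar x.
    by case/setU1P: wS' => [->|wS]; rewrite ?eqxx ?(neq_x w) ?le_x.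
  apply: (le_trans wS'); case/setU1P: aS' => [ax|aS].
    by rewrite ax eqxx fbound_ge ?eps_ge0 // -ax.
  rewrite (neq_x a) // (le_trans (x_min v _)) //.
    by apply/nbhdP; split=> //; exists a.
  exact: alpha_star_le astarP vS aS eav.
Qed.

Lemma proc_state_invariant S A :
  proc_state e eps u alpha S A -> proc_invariant S A.
Proof.
elim=> [B|T B T' B' _]; first exact: proc_invariant_init.
exact: proc_invariant_step.
Qed.

Lemma path_upper_end_ge (A : V -> R) p :
  A u = alpha -> (forall a b, e a b -> A b <= fbound (eps a b) (A a)) ->
  path e u p -> A (last u p) <= path_upper_end eps alpha u p.
Proof.
move=> Au A_edge; elim/last_ind: p => [_|p w IHp]; first by rewrite /= Au.
rewrite rcons_path last_rcons path_upper_end_rcons => /andP[/IHp le_p epw].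
exact: le_trans (A_edge _ _ epw) (fbound_homo _ le_p).
Qed.

(** A step writes only at a vertex outside the settled set, which always contains [u]. *)
Lemma proc_state_source S A : proc_state e eps u alpha S A -> A u = alpha.
Proof.
elim=> [//|T B T' B' /proc_state_invariant[uT _ _ _ _] Bu].
move=> [_ [astar [x [_ /nbhdP[xT _] _ _ ->]]]] /=.
by case: eqP => [ux|//]; rewrite -ux uT in xT.
Qed.

Lemma proc_step_exists (S : {set V}) (A : V -> R) :
  connected_graph e -> u \in S ->
  (#|S| < #|V|)%N -> exists S' A', proc_step e eps S A S' A'.
Proof.
move=> e_conn uS S_lt; have [astar astarP] := alpha_star_exists eps S A e_sym.
have [x xN [_ x_min]] :=
  @finset_is_min R _ _ astar (nbhd_neq0 e_sym e_conn uS S_lt).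
exists (x |: S), [eta A with x |-> astar x]; split=> //; exists astar, x.
by split=> // v vN; apply: x_min; exists v.
Qed.

End Procedure.

Theorem theorem4 (R : realType) (V : finType) (e : rel V)
    (eps : V -> V -> R) (u : V) (alpha : R)
    (simple_e : simple_graph e) (connected_e : connected_graph e)
    (eps_privacy : privacy_function e eps)
    (alpha01 : 0 <= alpha <= 1) :
  (* the loop body can always be executed, so the procedure has a result *)
  (forall (S : {set V}) (A : V -> R),
     proc_state e eps u alpha S A -> (#|S| < #|V|)%N ->
     exists (S' : {set V}) (A' : V -> R), proc_step e eps S A S' A') /\
  (forall A : V -> R, proc_result e eps u alpha A ->
     forall v : V,
       0 <= A v <= 1 /\
       is_min [set path_upper_end eps alpha u p | p in paths e u v]%classic
              (A v)).
Proof.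
have [e_sym _] := simple_e; split=> [S A SA S_lt|A [S [SA S_full]] v].
  have [uS _ _ _ _] := proc_state_invariant e_sym eps_privacy alpha01 SA.
  exact: (proc_step_exists eps e_sym A connected_e uS S_lt).
have [_ A01 A_att A_edge _] :=
  proc_state_invariant e_sym eps_privacy alpha01 SA.
(* At termination [S] has at least as many elements as [V], so the invariant covers every vertex and
   edge. *)
have inS w : w \in S.
  have /eqP-> : S == [set: V]%SET.
    by rewrite eqEcard finset.subsetT cardsT leqNgt.
  by rewrite inE.
split; first exact: A01.
split=> [|_ [p [p_path <-] <-]]; first exact: A_att.
apply: path_upper_end_ge p_path => [|a b]; last exact: A_edge.
exact: proc_state_source SA.
Qed.
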